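(* Let $n\ge2$. For $a>0$ let $\mathcal{C}_a=\{(X,y)\in\mathbb{R}^{n-1}\times\mathbb{R}:|y|=a|X|\}$. Then there is a constant $C$ depending only on $n$ such that for all $a,\bar a\in(0,1]$ and any ball $B_1\subseteq\mathbb{R}^n$ of radius $1$, $$\sup_{\tau\in\mathbb{R}^n}\big|(\mathcal{C}_a(\delta)+\tau)\cap\mathcal{C}_{\bar a}(\delta)\cap B_1\big|\le C\,\frac{\delta^2}{\delta+|\bar a-a|}\qquad\text{for all }\delta\in(0,1).$$
   Context: For $E\subseteq\mathbb{R}^n$, $E(\delta)=\{x+y:x\in E,\ y\in\mathbb{R}^n,\ |y|<\delta\}$ is the $\delta$-neighbourhood, and $|E|$ denotes Lebesgue measure. *)

(* Defs.v *)
From HB Require Import structures.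
From mathcomp Require Import all_boot all_order all_algebra.
From mathcomp Require Import all_classical all_reals all_analysis.
Set Implicit Arguments.
Unset Strict Implicit.
Unset Printing Implicit Defensive.
Import Order.TTheory GRing.Theory Num.Theory.
Import numFieldNormedType.Exports.

Local Open Scope classical_set_scope.
Local Open Scope ring_scope.

Section Euclidean.
Variables (R : realType) (n : nat).
Implicit Types (x y c t a b : 'rV[R]_n) (E A : set 'rV[R]_n).

(* The library norm `|x| on 'rV[R]_n is the sup norm, hence this definition. *)
Definition enorm x : R := Num.sqrt (\sum_(i < n) x ord0 i ^+ 2).

Definition ecball c (r : R) : set 'rV[R]_n := [set x | enorm (x - c) <= r].

Definition neighbourhood E (delta : R) : set 'rV[R]_n :=
  [set z | exists x y, [/\ E x, enorm y < delta & z = x + y]].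

Definition translate E t : set 'rV[R]_n := [set x + t | x in E].

Definition box a b : set 'rV[R]_n :=
  [set x | forall i, a ord0 i <= x ord0 i <= b ord0 i].

Definition box_volume a b : R := \prod_(i < n) (b ord0 i - a ord0 i).

(* The condition a_i <= b_i keeps box_volume nonnegative. *)
Definition box_cover A (a b : nat -> 'rV[R]_n) : Prop :=
  (forall k i, a k ord0 i <= b k ord0 i) /\ A `<=` \bigcup_k box (a k) (b k).

(* Lebesgue outer measure on R^n: the infimum of the total volume of a
   countable cover by boxes. It is defined on all subsets and is the Lebesgue
   measure on the measurable ones. *)
Definition lebesgue A : \bar R :=
  ereal_inf [set s : \bar R | exists a b : nat -> 'rV[R]_n,
    box_cover A a b /\
    s = (\sum_(0 <= k <oo) (box_volume (a k) (b k))%:E)%E].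

End Euclidean.

(* A point of R^p x R is the row vector row_mx X y, with y a 1 x 1 matrix. *)
Definition cone (R : realType) (p : nat) (a : R) : set 'rV[R]_(p + 1) :=
  [set z | exists (X : 'rV[R]_p) (y : R),
    z = row_mx X y%:M /\ `|y| = a * enorm X].
Arguments cone {R} p a.

(* Main.v *)
Require Import Defs.
From HB Require Import structures.
From mathcomp Require Import all_boot all_order all_algebra.
From mathcomp Require Import all_classical all_reals all_analysis.
From mathcomp Require Import ring lra.
Set Implicit Arguments.
Unset Strict Implicit.
Unset Printing Implicit Defensive.
Import Order.TTheory GRing.Theory Num.Theory.
Import numFieldNormedType.Exports.
Local Open Scope classical_set_scope.
Local Open Scope ring_scope.

(* The set is covered by cubes of side comparable to delta, and these are
   counted. Write p = n - 1 and say a <= b for the two slopes. On the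
   intersection, y is determined by X up to O(delta) and two signs, and
   f(X) = b|X - T| +- a|X - W| is constant up to O(delta), T and W being the
   horizontal positions of the apices. Along rays from T, f grows at rate at
   least b - a, so each radial tube of width delta meets the set in a segment
   of length O(delta / (delta + (b - a))). There are O(delta^(1 - p)) tubes
   meeting the unit ball, hence O(delta^(1 - p) / (delta + (b - a))) cubes of
   volume O(delta^(p + 1)). Rays are parametrised by the faces of the sup-norm
   ball, which needs no polar coordinates. *)

(** * The Euclidean norm on row vectors *)

Section EuclideanNorm.
Variables (R : realType) (n : nat).
Implicit Types x y : 'rV[R]_n.

Lemma enorm_ge0 x : 0 <= enorm x.
Proof. exact: sqrtr_ge0. Qed.

Lemma sqr_enorm x : enorm x ^+ 2 = \sum_(i < n) x ord0 i ^+ 2.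
Proof. by rewrite /enorm sqr_sqrtr// sumr_ge0// => i _; exact: sqr_ge0. Qed.

Lemma ler_norm_enorm x i : `|x ord0 i| <= enorm x.
Proof.
rewrite -(ler_pXn2r (n := 2)) ?nnegrE ?enorm_ge0 ?normr_ge0//.
rewrite sqr_enorm real_normK ?num_real// (bigD1 i)//= lerDl.
by rewrite sumr_ge0// => j _; exact: sqr_ge0.
Qed.

Lemma enorm0_eq0 x : enorm x = 0 -> x = 0.
Proof.
move=> x0; apply/rowP => i; rewrite mxE; apply/eqP; rewrite -normr_le0.
by rewrite -x0 ler_norm_enorm.
Qed.

Lemma enormZ (k : R) x : enorm (k *: x) = `|k| * enorm x.
Proof.
rewrite /enorm -sqrtr_sqr -sqrtrM ?sqr_ge0// mulr_sumr.
by congr Num.sqrt; apply: eq_bigr => i _; rewrite mxE exprMn.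
Qed.

(** Cauchy-Schwarz: expand the sum of the squares of |y| x_i - |x| y_i, which is nonnegative, and
    divide by 2|x||y|. *)
Lemma dotr_le_enorm x y :
  \sum_(i < n) x ord0 i * y ord0 i <= enorm x * enorm y.
Proof.
have [x0|x0] := eqVneq (enorm x) 0.
  rewrite x0 mul0r big1// => i _.
  by rewrite (enorm0_eq0 x0) mxE mul0r.
have [y0|y0] := eqVneq (enorm y) 0.
  rewrite y0 mulr0 big1// => i _.
  by rewrite (enorm0_eq0 y0) mxE mulr0.
have xy_gt0 : 0 < enorm x * enorm y.
  by rewrite mulr_gt0// lt0r ?x0 ?y0 enorm_ge0.
have : 0 <= \sum_(i < n) (enorm y * x ord0 i - enorm x * y ord0 i) ^+ 2.
  by apply: sumr_ge0 => i _; exact: sqr_ge0.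
rewrite (eq_bigr (fun i => enorm y ^+ 2 * x ord0 i ^+ 2
  + enorm x ^+ 2 * y ord0 i ^+ 2
  - 2 * (enorm x * enorm y) * (x ord0 i * y ord0 i))); last by move=> i _; ring.
rewrite sumrB big_split/= -!mulr_sumr -!sqr_enorm => H.
rewrite -(ler_pM2l xy_gt0); nra.
Qed.

Lemma enormD x y : enorm (x + y) <= enorm x + enorm y.
Proof.
rewrite -(ler_pXn2r (n := 2)) ?nnegrE ?addr_ge0 ?enorm_ge0//.
rewrite sqr_enorm (eq_bigr (fun i => x ord0 i ^+ 2 + y ord0 i ^+ 2
  + 2 * (x ord0 i * y ord0 i))); last by move=> i _; rewrite mxE; ring.
rewrite !big_split/= -mulr_sumr -!sqr_enorm.
have := dotr_le_enorm x y; nra.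
Qed.

Lemma enormB_sym x y : enorm (x - y) = enorm (y - x).
Proof. by rewrite -opprB -scaleN1r enormZ normrN1 mul1r. Qed.

Lemma ler_dist_enorm x y : `|enorm x - enorm y| <= enorm (x - y).
Proof.
rewrite ler_norml; apply/andP; split.
  by have := enormD (y - x) x; rewrite subrK enormB_sym; lra.
by have := enormD (x - y) y; rewrite subrK; lra.
Qed.

Lemma enorm_le_const x (e : R) :
  (forall i, `|x ord0 i| <= e) -> enorm x <= n%:R * e.
Proof.
(* In dimension 0 the hypothesis is vacuous and [e] may be negative, but both sides vanish. *)
move=> xe; have [i0|n0] := pselect (exists i : 'I_n, true); last first.
  rewrite /enorm big1 ?sqrtr0; last by move=> i; case: n0; exists i.
  case: (posnP n) => [->|n1]; first by rewrite mul0r.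
  by case: n0; exists (Ordinal n1).
have [i _] := i0; have e0 : 0 <= e by exact: le_trans (xe i).
have n1 : 1 <= n%:R :> R by rewrite ler1n; case: (n) i => [[]|].
rewrite -(ler_pXn2r (n := 2)) ?nnegrE ?enorm_ge0 ?mulr_ge0//.
rewrite sqr_enorm (@le_trans _ _ (\sum_(i < n) e ^+ 2))//.
  apply: ler_sum => j _; rewrite -[x ord0 j ^+ 2]real_normK ?num_real//.
  by rewrite ler_pXn2r ?nnegrE.
rewrite sumr_const card_ord -[leLHS]mulr_natl exprMn ler_wpM2r ?sqr_ge0//.
by rewrite expr2 ler_peMl//; lra.
Qed.

End EuclideanNorm.

(** * Counting cubes and bounding the outer measure *)

Section CoverByCubes.
Variables (R : realType) (n : nat).
Implicit Types (A B : set 'rV[R]_n) (r N : R).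

(** [r] is half the side of the cubes. The bound [N] is real, so that counts such as 2l/h + 1 need
    no rounding. *)
Definition cube_cover A r N := exists s : seq 'rV[R]_n,
  (size s)%:R <= N /\
  forall z, A z -> exists2 x, x \in s & forall i, `|z ord0 i - x ord0 i| <= r.

Lemma cube_cover_sub A B r N : A `<=` B -> cube_cover B r N -> cube_cover A r N.
Proof. by move=> AB [s [sN sB]]; exists s; split=> // z /AB/sB. Qed.

Lemma cube_cover_diam A r :
  (forall z z', A z -> A z' -> forall i, `|z ord0 i - z' ord0 i| <= r) ->
  cube_cover A r 1.
Proof.
move=> Ar; have [[z0 Az0]|A0] := pselect (exists z, A z); last first.
  by exists [::]; split=> // z Az; case: A0; exists z.
exists [:: z0]; split=> // z Az; exists z0; rewrite ?inE//.
exact: Ar.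
Qed.

Lemma cube_cover_bigcup (I : finType) A (F : I -> set 'rV[R]_n) r N :
  (forall z, A z -> exists i, F i z) -> (forall i, cube_cover (F i) r N) ->
  cube_cover A r (#|I|%:R * N).
Proof.
move=> AF /choice[s Hs]; exists (flatten [seq s i | i <- enum I]); split.
  rewrite size_flatten /shape -map_comp sumnE big_map natr_sum big_enum/=.
  rewrite mulr_natl -sumr_const.
  by apply: ler_sum => i _ /=; have [] := Hs i.
move=> z /AF[i Fiz]; have [_ /(_ z Fiz)[x xs xz]] := Hs i.
by exists x => //; apply/flatten_mapP; exists i; rewrite ?mem_enum.
Qed.

(** The values of [g] lie within [l] of any one of them, hence in an interval of length 2l, which is
    cut into pieces of length [h]. *)
Lemma cube_cover_slice A r N (g : 'rV[R]_n -> R) (l h : R) :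
  0 <= l -> 0 < h -> 0 <= N ->
  (forall z z', A z -> A z' -> `|g z - g z'| <= l) ->
  (forall B, B `<=` A ->
    (forall z z', B z -> B z' -> `|g z - g z'| <= h) -> cube_cover B r N) ->
  cube_cover A r ((2 * l / h + 1) * N).
Proof.
move=> l0 h0 N0 Al AB.
have lh0 : 0 <= 2 * l / h by rewrite divr_ge0 ?mulr_ge0// ltW.
have [[z0 Az0]|A0] := pselect (exists z, A z); last first.
  exists [::]; split=> [|z Az]; last by case: A0; exists z.
  by rewrite mulr_ge0// addr_ge0.
(* Offset from the left end of the interval around [g z0], in units of [h]; its integer part,
   between 0 and [m], labels the slice. *)
pose w z := (g z - g z0 + l) / h.
have w0 z : A z -> 0 <= w z.
  move=> Az; apply: divr_ge0; last exact: ltW.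
  by have := Al _ _ Az Az0; rewrite ler_norml; lra.
pose m := Num.truncn (2 * l / h).
have [s [sN sA]] : cube_cover A r (#|'I_m.+1|%:R * N).
  apply: (@cube_cover_bigcup 'I_m.+1 _
    (fun i : 'I_m.+1 => A `&` [set z | Num.truncn (w z) = i :> nat])) => [z Az|i].
    have wm : (Num.truncn (w z) < m.+1)%N.
      rewrite ltnS; apply: le_truncn; rewrite ler_pM2r ?invr_gt0//.
      by have := Al _ _ Az Az0; rewrite ler_norml; lra.
    by exists (Ordinal wm).
  apply: AB => [z []//|z z' [Az wz] [Az' wz']].
  have := truncn_itv (w0 _ Az); have := truncn_itv (w0 _ Az').
  rewrite wz wz' -!natr1 => H' H.
  have E v : g v = w v * h + g z0 - l by rewrite /w divfK ?gt_eqF//; ring.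
  by rewrite (E z) (E z') ler_norml; nra.
exists s; split=> //; apply: le_trans sN _.
rewrite card_ord ler_wpM2r// -natr1 lerD2r.
by have /andP[] := truncn_itv lh0.
Qed.

Lemma cube_cover_slices (J : eqType) (js : seq J) A r N
    (g : J -> 'rV[R]_n -> R) (l h : R) :
  0 <= l -> 0 < h -> 0 <= N ->
  (forall j, j \in js -> forall z z', A z -> A z' -> `|g j z - g j z'| <= l) ->
  (forall B, B `<=` A ->
    (forall j, j \in js -> forall z z', B z -> B z' -> `|g j z - g j z'| <= h) ->
    cube_cover B r N) ->
  cube_cover A r ((2 * l / h + 1) ^+ size js * N).
Proof.
move=> l0 h0 N0; elim: js A => [|j js IH] A Al AB /=.
  by rewrite expr0 mul1r; exact: AB.
have lh0 : 0 <= 2 * l / h + 1 by rewrite addr_ge0// divr_ge0 ?mulr_ge0// ltW.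
rewrite exprS -mulrA; apply: (@cube_cover_slice _ _ _ (g j)) => //.
- by rewrite mulr_ge0// exprn_ge0.
- by move=> *; apply: Al => //; rewrite mem_head.
move=> B BA Bh; apply: IH => [k kjs z z' Bz Bz'|D DB Dh].
  by apply: Al; rewrite ?in_cons ?kjs ?orbT//; exact: BA.
apply: AB => [z /DB/BA//|k]; rewrite in_cons => /predU1P[->|/Dh//].
by move=> z z' /DB Bz /DB; exact: Bh.
Qed.

Lemma lebesgue_cube_cover A r N : (0 < n)%N -> 0 <= r -> cube_cover A r N ->
  (lebesgue A <= (N * (2 * r) ^+ n)%:E)%E.
Proof.
move=> n0 r0 [s [sN sA]].
(* The finite list is padded to a sequence by one-point boxes at the origin, whose volume 0 ^+ n
   vanishes because n > 0. *)
pose hw k : R := if (k < size s)%N then r else 0.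
pose lo k : 'rV[R]_n := \row_i ((nth 0 s k) ord0 i - hw k).
pose hi k : 'rV[R]_n := \row_i ((nth 0 s k) ord0 i + hw k).
have hw0 k : 0 <= hw k by rewrite /hw; case: ifP.
have vol k : box_volume (lo k) (hi k) = (2 * hw k) ^+ n.
  rewrite /box_volume (eq_bigr (fun=> 2 * hw k)) => [|i _].
    by rewrite prodr_const card_ord.
  by rewrite !mxE; ring.
apply: (@le_trans _ _ (\sum_(0 <= k <oo) (box_volume (lo k) (hi k))%:E)%E).
  apply: ereal_inf_lbound; exists lo, hi; split=> //; split=> [k i|z Az].
    by rewrite !mxE; have := hw0 k; lra.
  have [x xs xz] := sA _ Az; exists (index x s) => //= i.
  rewrite !mxE /hw index_mem xs nth_index//.
  by have := xz i; rewrite ler_norml; lra.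
rewrite (nneseries_split _ (size s)) ?add0n; last first.
  by move=> k _; rewrite lee_fin vol exprn_ge0// mulr_ge0.
rewrite (@eseries0 _ _ (size s)) ?adde0; last first.
  by move=> k sk _; rewrite vol /hw ltnNge sk/= mulr0 expr0n gtn_eqF.
rewrite sumEFin lee_fin big_mkord (eq_bigr (fun=> (2 * r) ^+ n)); last first.
  by move=> i _; rewrite vol /hw ltn_ord.
rewrite sumr_const card_ord -[leLHS]mulr_natl ler_wpM2r//.
by rewrite exprn_ge0// mulr_ge0.
Qed.

End CoverByCubes.

(** * Radial growth, and shells around cones *)

Lemma rowB (R : realType) (n : nat) (x y : 'rV[R]_n) j :
  (x - y) ord0 j = x ord0 j - y ord0 j.
Proof. by rewrite !mxE. Qed.

Lemma rowZ (R : realType) (n : nat) (k : R) (x : 'rV[R]_n) j :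
  (k *: x) ord0 j = k * x ord0 j.
Proof. by rewrite mxE. Qed.

(* Radially, b|X| grows at rate b while a|X - W| changes at rate at most a;
   passing from the ray of U to the nearby ray of U' costs 2e. *)
Lemma radial_growth (R : realType) (p : nat) (U U' W : 'rV[R]_p)
    (rho rho' a b e : R) :
  0 <= a -> a <= b -> b <= 1 -> 0 <= rho -> rho <= rho' -> 1 <= enorm U ->
  enorm (rho' *: U' - rho' *: U) <= e ->
  (b - a) * (rho' - rho) <=
    b * (enorm (rho' *: U') - enorm (rho *: U))
    - a * `|enorm (rho' *: U' - W) - enorm (rho *: U - W)| + 2 * e.
Proof.
move=> a0 ab b1 rho0 rho_le U1 He.
have e0 : 0 <= e by exact: le_trans (enorm_ge0 _) He.
have EU r : 0 <= r -> enorm (r *: U) = r * enorm U.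
  by move=> r0; rewrite enormZ ger0_norm.
have H1 : rho' * enorm U - e <= enorm (rho' *: U').
  rewrite -EU; last exact: le_trans rho_le.
  by have := ler_dist_enorm (rho' *: U') (rho' *: U); rewrite ler_norml; lra.
have H2 : `|enorm (rho' *: U' - W) - enorm (rho *: U - W)|
    <= e + (rho' - rho) * enorm U.
  apply: le_trans (ler_dist_enorm _ _) _; rewrite opprB addrA subrK.
  rewrite -EU ?subr_ge0// scalerBl.
  have -> : rho' *: U' - rho *: U =
      (rho' *: U' - rho' *: U) + (rho' *: U - rho *: U) by rewrite addrA subrK.
  by apply: le_trans (enormD _ _) _; rewrite lerD2r.
rewrite [enorm (rho *: U)]EU//.
have H3 := ler_wpM2l a0 H2.
have H4 : b * (rho' * enorm U - e) <= b * enorm (rho' *: U').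
  by rewrite ler_wpM2l// (le_trans a0).
have H5 : (b - a) * (rho' - rho) <= (b - a) * ((rho' - rho) * enorm U).
  by rewrite ler_wpM2l ?subr_ge0// ler_peMr ?subr_ge0.
have H6 : b * e <= e by rewrite ler_piMl.
have H7 : a * e <= e by rewrite ler_piMl// (le_trans ab).
lra.
Qed.

Section ConeShell.
Variables (R : realType) (p : nat).
Implicit Types (z tau : 'rV[R]_(p + 1)) (a t delta : R) (T : 'rV[R]_p).

Definition height z := z ord0 (rshift p ord0).

(** The thickened cone with apex (T, t) as a single inequality. Moving a point by [delta] changes
    the height by at most [delta], and the term a|X - T| too since a <= 1, hence the factor 2. *)
Definition cone_shell a T t delta : set 'rV[R]_(p + 1) :=
  [set z | `| `|height z - t| - a * enorm (lsubmx z - T)| <= 2 * delta].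

Lemma enorm_lsubmx z : enorm (lsubmx z) <= enorm z.
Proof.
rewrite /enorm ler_wsqrtr// big_split_ord/= (eq_bigr (fun i =>
  z ord0 (lshift 1 i) ^+ 2)) => [|i _]; last by rewrite mxE.
by rewrite lerDl sumr_ge0// => i _; exact: sqr_ge0.
Qed.

Lemma translate_neighbourhood_cone a delta tau z : 0 <= a <= 1 ->
  translate (neighbourhood (cone p a) delta) tau z ->
  cone_shell a (lsubmx tau) (height tau) delta z.
Proof.
move=> /andP[a0 a1] [_ [_ [e [[X [y [-> yX]] elt ->]]] <-]].
rewrite /cone_shell/= /height !linearD/= row_mxKl addrK.
rewrite 2!mxE row_mxEr mxE eqxx mulr1n addrK.
have He := le_trans (ler_norm_enorm e (rshift p ord0)) (ltW elt).
have HX : `|enorm (X + lsubmx e) - enorm X| <= delta.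
  apply: le_trans (ler_dist_enorm _ _) _; rewrite addrC addKr.
  exact: le_trans (enorm_lsubmx _) (ltW elt).
have Hy : `| `|y + e ord0 (rshift p ord0)| - `|y| | <= delta.
  by apply: le_trans (ler_dist_dist _ _) _; rewrite addrC addKr.
have Ha : `|a * enorm (X + lsubmx e) - a * enorm X| <= delta.
  by rewrite -mulrBr normrM (ger0_norm a0) (le_trans _ HX)// ler_piMl.
by move: Hy Ha; rewrite yX !ler_norml; lra.
Qed.

Lemma neighbourhood_cone a delta z : 0 <= a <= 1 ->
  neighbourhood (cone p a) delta z -> cone_shell a 0 0 delta z.
Proof.
move=> a01 nz; have := @translate_neighbourhood_cone a delta 0 z a01.
rewrite /height linear0 mxE; apply.
by exists z; rewrite ?addr0.
Qed.

Lemma ecball_dist c z z' i : ecball c 1 z -> ecball c 1 z' ->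
  `|z ord0 i - z' ord0 i| <= 2.
Proof.
rewrite /ecball/= => zc zc'.
have := le_trans (ler_norm_enorm _ i) zc.
have := le_trans (ler_norm_enorm _ i) zc'.
by rewrite !mxE !ler_norml; lra.
Qed.

End ConeShell.

(** On a fixed side of each apex the absolute values become affine, so y - y' equals B - B' up to
    sign and 4 delta, and likewise A - A'. Eliminating y - y' gives the 8 delta. *)
Lemma shell_dist (R : realType) (s1 s2 : bool)
    (y y' t w A A' B B' delta : R) :
  (if s1 then 0 <= y - t else y - t <= 0) ->
  (if s1 then 0 <= y' - t else y' - t <= 0) ->
  (if s2 then 0 <= y - w else y - w <= 0) ->
  (if s2 then 0 <= y' - w else y' - w <= 0) ->
  `| `|y - t| - B| <= 2 * delta -> `| `|y' - t| - B'| <= 2 * delta ->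
  `| `|y - w| - A| <= 2 * delta -> `| `|y' - w| - A'| <= 2 * delta ->
  `|y - y'| <= 4 * delta + `|B - B'| /\
  `|B - B'| <= 8 * delta + `|A - A'|.
Proof.
have := ler_norm (B - B'); have := ler_norm (- (B - B')); rewrite normrN.
have := ler_norm (A - A'); have := ler_norm (- (A - A')); rewrite normrN.
case: s1; case: s2 => ? ? ? ? h1 h1' h2 h2';
  rewrite ?(ger0_norm h1) ?(ler0_norm h1) ?(ger0_norm h1') ?(ler0_norm h1')
    ?(ger0_norm h2) ?(ler0_norm h2) ?(ger0_norm h2') ?(ler0_norm h2');
  rewrite !(ler_norml _ (2 * _)) => /andP[? ?] /andP[? ?] /andP[? ?] /andP[? ?];
  by rewrite !ler_norml; split; lra.
Qed.

(** * Covering the intersection of two shells in a unit ball *)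

Section ShellIntersection.
Variables (R : realType) (q : nat).
Notation p := q.+1.
Variables (a b t w delta : R) (T W : 'rV[R]_p) (c : 'rV[R]_(p + 1)).
Hypotheses (a_ge0 : 0 <= a) (le_ab : a <= b) (b_le1 : b <= 1).
Hypotheses (delta_gt0 : 0 < delta) (delta_lt1 : delta < 1).

Let A : set 'rV[R]_(p + 1) :=
  cone_shell b T t delta `&` cone_shell a W w delta `&` ecball c 1.

(** Positions relative to the apex of the steeper cone, whose rays yield the growth rate b - a. *)
Let x (z : 'rV[R]_(p + 1)) : 'rV[R]_p := lsubmx z - T.

Let xB z z' j : x z ord0 j - x z' ord0 j =
  z ord0 (lshift 1 j) - z' ord0 (lshift 1 j).
Proof. by rewrite !mxE; ring. Qed.

Section Sector.
Variables (i : 'I_p) (s s1 s2 : bool).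

Let rho z := (-1) ^+ s * x z ord0 i.
(* The i-th entry is forced to be a sign so that [enorm (u z) >= 1] and
   [x z = rho z *: u z] survive at the apex, where [rho z = 0]. *)
Let u z : 'rV[R]_p :=
  \row_j (if j == i then (-1) ^+ s else x z ord0 j / rho z).

(** Here [rho z] is the sup norm of [x z], and [u z] lies on the face of the unit cube given by [i]
    and [s]. The signs [s1] and [s2] fix the sides needed by [shell_dist]. *)
Definition sector : set 'rV[R]_(p + 1) := [set z | [/\ A z,
  forall j, `|x z ord0 j| <= rho z,
  if s1 then 0 <= height z - t else height z - t <= 0 &
  if s2 then 0 <= height z - w else height z - w <= 0]].

Let rho_ge0 z : sector z -> 0 <= rho z.
Proof. by case=> _ /(_ i) + _ _; exact: le_trans. Qed.

Let xE z : sector z -> x z = rho z *: u z.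
Proof.
move=> Sz; have [_ xle _ _] := Sz; apply/rowP => j; rewrite [RHS]mxE [X in _ * X]mxE.
case: eqP => [->|_]; first by rewrite mulrC mulrA -expr2 sqrr_sign mul1r.
have [r0|r0] := eqVneq (rho z) 0; last by rewrite mulrC divfK.
by rewrite r0 mul0r; apply/eqP; rewrite -normr_le0 -r0.
Qed.

Let xEj z j : sector z -> x z ord0 j = rho z * u z ord0 j.
Proof. by move=> Sz; rewrite {1}(xE Sz) rowZ. Qed.

Let u_le1 z j : sector z -> `|u z ord0 j| <= 1.
Proof.
move=> Sz; have [_ xle _ _] := Sz; rewrite mxE.
case: eqP => [_|_]; first by rewrite normr_sign.
have [r0|r0] := eqVneq (rho z) 0; first by rewrite r0 invr0 mulr0 normr0.
rewrite normrM normfV (ger0_norm (rho_ge0 Sz)) ler_pdivrMr ?mul1r//.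
by rewrite lt0r r0 rho_ge0.
Qed.

Let u_ge1 z : 1 <= enorm (u z).
Proof.
by apply: le_trans (ler_norm_enorm _ i); rewrite mxE eqxx normr_sign.
Qed.

Let x_dist z z' j : sector z -> sector z' ->
  `|x z ord0 j - x z' ord0 j| <= 2.
Proof.
move=> [[_ Bz] _ _ _] [[_ Bz'] _ _ _].
by rewrite xB; exact: (ecball_dist _ Bz Bz').
Qed.

Let rho_dist z z' : sector z -> sector z' -> `|rho z - rho z'| <= 2.
Proof. by move=> Sz Sz'; rewrite -mulrBr normrM normr_sign mul1r x_dist. Qed.

Let u_dist z z' j : sector z -> sector z' ->
  rho z * `|u z ord0 j - u z' ord0 j| <= 4.
Proof.
move=> Sz Sz'; rewrite -{1}(ger0_norm (rho_ge0 Sz)) -normrM.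
have -> : rho z * (u z ord0 j - u z' ord0 j) =
    (x z ord0 j - x z' ord0 j) + (rho z' - rho z) * u z' ord0 j.
  by rewrite (xEj j Sz) (xEj j Sz'); ring.
apply: le_trans (ler_normD _ _) _; rewrite normrM.
have := x_dist j Sz Sz'; have := rho_dist Sz' Sz.
have := u_le1 j Sz'; have := normr_ge0 (rho z' - rho z).
have := normr_ge0 (u z' ord0 j); nra.
Qed.

Variable z0 : 'rV[R]_(p + 1).
Hypothesis Sz0 : sector z0.
(* An upper bound for [rho] on the sector. Slicing [u] at scale [delta / M]
   keeps the number of tubes bounded even when the ball is far from the apex,
   because [u] then oscillates by only [O(1 / M)]. *)
Let M := rho z0 + 2.

Let M_gt0 : 0 < M.
Proof. by have := rho_ge0 Sz0; rewrite /M; lra. Qed.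

Let rho_leM z : sector z -> rho z <= M.
Proof. by move=> /rho_dist/(_ Sz0); rewrite /M ler_norml; lra. Qed.

Let u_dist_M z z' j : sector z -> sector z' ->
  `|u z ord0 j - u z' ord0 j| <= 12 / M.
Proof.
move=> Sz Sz'; rewrite ler_pdivlMr//.
(* Since M <= rho z + 4 and entries of [u] differ by at most 2, [u_dist] gives 4 + 4 * 2 = 12. *)
have := u_dist j Sz Sz'; have := rho_dist Sz Sz0.
rewrite ler_norml => /andP[h _] h1.
have h2 : `|u z ord0 j - u z' ord0 j| <= 2.
  apply: le_trans (ler_normB _ _) _.
  by have := u_le1 j Sz; have := u_le1 j Sz'; lra.
have := normr_ge0 (u z ord0 j - u z' ord0 j).
rewrite /M; nra.
Qed.

Section Tube.
Variable B : set 'rV[R]_(p + 1).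
Hypothesis BS : B `<=` sector.
Hypothesis Bu : forall j, j != i ->
  forall z z', B z -> B z' -> `|u z ord0 j - u z' ord0 j| <= delta / M.

Let rho_u_dist z z' v j : B z -> B z' -> sector v ->
  `|rho v * (u z ord0 j - u z' ord0 j)| <= delta.
Proof.
move=> Bz Bz' Sv; rewrite normrM (ger0_norm (rho_ge0 Sv)).
have h : `|u z ord0 j - u z' ord0 j| <= delta / M.
  have [->|ji] := eqVneq j i; last exact: Bu.
  by rewrite !mxE eqxx subrr normr0 divr_ge0 ?ltW.
rewrite -[leRHS](divfK (lt0r_neq0 M_gt0)) mulrC.
by rewrite ler_pM// ?rho_ge0// rho_leM.
Qed.

Let enorm_rho_u_dist z z' v : B z -> B z' -> sector v ->
  enorm (rho v *: u z - rho v *: u z') <= p%:R * delta.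
Proof.
move=> Bz Bz' Sv; apply: enorm_le_const => j.
by rewrite -scalerBr rowZ rowB; exact: rho_u_dist.
Qed.

(** 8 comes from [shell_dist], 2p from changing rays in [radial_growth], and 2 from the diameter of
    the ball. *)
Let K : R := 10 + 2 * p%:R.

Let shells z z' : sector z -> sector z' ->
  `|height z - height z'| <= 4 * delta + `|b * enorm (x z) - b * enorm (x z')|
  /\ `|b * enorm (x z) - b * enorm (x z')| <= 8 * delta
    + `|a * enorm (lsubmx z - W) - a * enorm (lsubmx z' - W)|.
Proof.
move=> [[[Cb Ca] _] _ h1 h2] [[[Cb' Ca'] _] _ h1' h2'].
exact: (shell_dist h1 h1' h2 h2' Cb Cb' Ca Ca').
Qed.

(** [shell_dist] bounds from above the same difference that [radial_growth] bounds from below by (b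
    - a)(rho' - rho). Adding the trivial bound rho' - rho <= 2 times [delta] puts [delta] in the
    denominator, so b = a is allowed. *)
Lemma rho_tube z z' : B z -> B z' ->
  `|rho z - rho z'| <= K * delta / (delta + (b - a)).
Proof.
wlog rle : z z' / rho z <= rho z' => [H Bz Bz'|].
  have [/H|/ltW/H] := leP (rho z) (rho z'); first exact.
  by rewrite distrC; exact.
move=> Bz Bz'; have [Sz Sz'] := (BS Bz, BS Bz').
rewrite distrC ger0_norm ?subr_ge0// ler_pdivlMr; last by move: le_ab delta_gt0; lra.
have h2 := rho_dist Sz' Sz.
have hg := radial_growth (W - T) a_ge0 le_ab b_le1 (rho_ge0 Sz) rle (u_ge1 z)
  (enorm_rho_u_dist Bz' Bz Sz').
have [_ hs] := shells Sz' Sz.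
have xW v : sector v -> rho v *: u v - (W - T) = lsubmx v - W.
  by move=> Sv; rewrite -xE// /x opprB addrA subrK.
rewrite !xW// -!xE// in hg.
rewrite -!mulrBr [X in _ <= _ + X]normrM (ger0_norm a_ge0) in hs.
have := le_trans (ler_norm _) hs => hs1.
have h3 : (rho z' - rho z) * delta <= 2 * delta.
  by rewrite ler_wpM2r ?(ltW delta_gt0)// (le_trans (ler_norm _)).
rewrite /K; lra.
Qed.

Lemma tube_cover :
  cube_cover B ((4 + 2 * p%:R) * delta) ((2 * K + 2) / (delta + (b - a))).
Proof.
have d0 : 0 < delta + (b - a) by move: le_ab delta_gt0; lra.
have K0 : 0 <= K by rewrite /K addr_ge0// mulr_ge0.
have : cube_cover B ((4 + 2 * p%:R) * delta)
    ((2 * (K * delta / (delta + (b - a))) / delta + 1) * 1).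
  apply: (cube_cover_slice (g := rho)) => //.
  - by rewrite divr_ge0 ?mulr_ge0// ltW.
  - exact: rho_tube.
  move=> D DB Dh; apply: cube_cover_diam => z z' Dz Dz'.
  have [Sz Sz'] := (BS (DB _ Dz), BS (DB _ Dz')).
  have xd j : `|x z ord0 j - x z' ord0 j| <= 2 * delta.
    rewrite (xEj j Sz) (xEj j Sz').
    have -> : rho z * u z ord0 j - rho z' * u z' ord0 j =
      rho z * (u z ord0 j - u z' ord0 j) + (rho z - rho z') * u z' ord0 j.
      by ring.
    apply: le_trans (ler_normD _ _) _; rewrite [X in _ + X]normrM.
    have := rho_u_dist j (DB _ Dz) (DB _ Dz') Sz.
    have := u_le1 j Sz'; have := Dh _ _ Dz Dz'.
    have := normr_ge0 (rho z - rho z'); have := normr_ge0 (u z' ord0 j); nra.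
  have p1 : 1 <= p%:R :> R by rewrite ler1n.
  move=> k; case: (splitP k) => [j kj|j kj].
    have -> : k = lshift 1 j by exact/val_inj.
    apply: (@le_trans _ _ (2 * delta)); last by move: delta_gt0; nra.
    by rewrite -xB.
  have -> : k = rshift p ord0 by apply/val_inj; rewrite /= kj ord1.
  (* The height varies by 4 delta plus b|x - x'| <= 2p delta, which sets the half-side of the
     cubes. *)
  have [hy _] := shells Sz Sz'; apply: le_trans hy _.
  have ex : enorm (x z - x z') <= p%:R * (2 * delta).
    by apply: enorm_le_const => l; rewrite rowB.
  have bx : `|b * enorm (x z) - b * enorm (x z')| <= p%:R * (2 * delta).
    rewrite -mulrBr normrM ger0_norm ?(le_trans a_ge0)//.
    apply: le_trans _ ex; apply: le_trans _ (ler_dist_enorm _ _).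
    by rewrite ler_piMl.
  by move: bx; lra.
case=> r [rN rB]; exists r; split=> //; apply: le_trans rN _.
(* The extra slice is absorbed because delta + (b - a) <= 2. *)
rewrite mulr1 ler_pdivlMr// mulrDl mul1r.
have -> : 2 * (K * delta / (delta + (b - a))) / delta * (delta + (b - a)) = 2 * K.
  by field; rewrite !gt_eqF.
by move: b_le1 a_ge0 delta_lt1; lra.
Qed.

End Tube.

(** Only the q entries of [u] other than the constant i-th are sliced. In the slice count [M]
    cancels, and 24 / delta + 1 <= 25 / delta as delta < 1. *)
Lemma sector_cover : cube_cover sector ((4 + 2 * p%:R) * delta)
  ((25 / delta) ^+ q * ((22 + 4 * p%:R) / (delta + (b - a)))).
Proof.
have d0 : 0 < delta + (b - a) by move: le_ab delta_gt0; lra.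
have N0 : 0 <= (22 + 4 * p%:R) / (delta + (b - a)).
  by rewrite divr_ge0 ?ltW// addr_gt0// mulr_gt0.
have [r [rN rS]] : cube_cover sector ((4 + 2 * p%:R) * delta)
  ((2 * (12 / M) / (delta / M) + 1) ^+ size (enum (predC1 i)) *
    ((22 + 4 * p%:R) / (delta + (b - a)))).
  apply: (cube_cover_slices (g := fun j z => u z ord0 j)) => //.
  - by rewrite divr_ge0// ltW.
  - by rewrite divr_gt0.
  - by move=> j _ z z'; exact: u_dist_M.
  move=> B BS Bu.
  have -> : 22 + 4 * p%:R = 2 * (10 + 2 * p%:R) + 2 :> R by ring.
  by apply: tube_cover => // j ji; apply: Bu; rewrite mem_enum.
exists r; split=> //; apply: le_trans rN _.
rewrite -cardE cardC1 card_ord/= ler_wpM2r//.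
have -> : 2 * (12 / M) / (delta / M) = 24 / delta.
  by field; rewrite !gt_eqF.
have dV : 1 <= delta^-1 by rewrite invf_ge1// ltW.
by apply: lerXn2r; rewrite ?nnegrE; move: dV; lra.
Qed.

End Sector.

Lemma shells_cover : cube_cover A ((4 + 2 * p%:R) * delta)
  ((p * 8)%:R * ((25 / delta) ^+ q * ((22 + 4 * p%:R) / (delta + (b - a))))).
Proof.
have d0 : 0 < delta + (b - a) by move: le_ab delta_gt0; lra.
have -> : (p * 8)%N = #|{: 'I_p * (bool * bool * bool)}|.
  by rewrite !card_prod card_ord card_bool.
apply: (cube_cover_bigcup (F := fun k : 'I_p * (bool * bool * bool) =>
    sector k.1 k.2.1.1 k.2.1.2 k.2.2)) => [z Az|[i [[s s1] s2]]]; last first.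
  (* A point of the sector is needed to define [M]. *)
  have [[z0 Sz0]|S0] := pselect (exists z, sector i s s1 s2 z).
    exact: sector_cover Sz0.
  exists [::]; split=> [|z Sz]; last by case: S0; exists z.
  rewrite mulr_ge0 ?exprn_ge0 ?divr_ge0// ?ltW// addr_gt0// mulr_gt0//.
(* The face is chosen by an entry of largest modulus and its sign; with the sides of the two apices
   this makes 8p sectors. *)
have [i _ imax] := @Order.TotalTheory.arg_maxP _ R 'I_p ord0 xpredT
  (fun j => `|x z ord0 j|) isT.
exists (i, (x z ord0 i < 0, 0 <= height z - t, 0 <= height z - w)); split=> //=.
- by move=> j; rewrite -normrEsign; exact: imax.
- by case: leP => // /ltW.
- by case: leP => // /ltW.
Qed.

End ShellIntersection.

(** * From the cube count to the measure estimate *)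

Theorem theorem1p9 (R : realType) (n : nat) (hn : (2 <= n)%N) :
  exists C : R,
    forall (a abar : R), 0 < a <= 1 -> 0 < abar <= 1 ->
    forall (c : 'rV[R]_(n.-1 + 1)) (delta : R), 0 < delta < 1 ->
    (ereal_sup [set lebesgue
                      (translate (neighbourhood (cone n.-1 a) delta) tau
                       `&` neighbourhood (cone n.-1 abar) delta
                       `&` ecball c 1)
               | tau in [set: 'rV[R]_(n.-1 + 1)]]
     <= (C * (delta ^+ 2 / (delta + `|abar - a|)))%:E)%E.
Proof.
case: n hn => [|[|q]]// _ /=.
pose r : R := 4 + 2 * q.+1%:R.
exists ((q.+1 * 8)%:R * 25 ^+ q * (22 + 4 * q.+1%:R) * (2 * r) ^+ (q.+1 + 1)).
move=> a abar /andP[a0 a1] /andP[b0 b1] c delta /andP[d0 d1].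
apply: ub_ereal_sup => _ [tau _ <-].
set S := (X in lebesgue X).
have r0 : 0 <= r * delta by rewrite mulr_ge0 ?addr_ge0 ?mulr_ge0// ltW.
suff cov : cube_cover S (r * delta) ((q.+1 * 8)%:R * ((25 / delta) ^+ q
    * ((22 + 4 * q.+1%:R) / (delta + `|abar - a|)))).
  have n0 : (0 < q.+1 + 1)%N by [].
  apply: le_trans (lebesgue_cube_cover n0 r0 cov) _.
  (* The constant was chosen to give equality: delta^(-q) from the tubes times delta^(q + 2) from
     the cube volume leaves delta^2. *)
  rewrite lee_fin le_eqVlt; apply/orP; left; apply/eqP.
  have dne : delta ^+ q != 0 by rewrite expf_neq0// gt_eqF.
  have sne : delta + `|abar - a| != 0 by rewrite gt_eqF// ltr_pwDl.
  rewrite (mulrA 2) (exprMn _ (2 * r)) (exprMn _ 25) exprVn.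
  rewrite addn1 (exprS delta q.+1) (exprS delta q).
  by move: (_ ^+ q.+2) (delta ^+ q) dne => P D D0; field; rewrite D0 sne.
have incl : S `<=` cone_shell a (lsubmx tau) (height tau) delta
    `&` cone_shell abar 0 0 delta `&` ecball c 1.
  move=> z [[nz nz'] Bz]; split=> //; split.
    by apply: translate_neighbourhood_cone; rewrite ?(ltW a0).
  by apply: neighbourhood_cone; rewrite ?(ltW b0).
(* The steeper cone must supply the centre of the rays: the origin if it is the fixed cone, [tau]
   otherwise. *)
have [ab|/ltW ab] := leP a abar.
  rewrite ger0_norm ?subr_ge0//; apply: cube_cover_sub _ (shells_cover
    0 (height tau) 0 (lsubmx tau) c (ltW a0) ab b1 d0 d1).
  by move=> z /incl[[]].
rewrite distrC ger0_norm ?subr_ge0//; apply: cube_cover_sub _ (shells_cover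
  (height tau) 0 (lsubmx tau) 0 c (ltW b0) ab a1 d0 d1).
exact: incl.
Qed.
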